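(* Let $H$ be a digraph with maximum degree $\Delta$, let $\delta>0$, and let $p=p(n)\in(0,1)$. (a) If $n^{-1/\Delta}\ll p\ll 1$, then as $n\to\infty$, \[ \frac{\Phi_{n,p}(H,\delta)}{n^2p^\Delta\log(1/p)}\le F(H,\delta)+o(1). \] Further, the infimum $F(H,\delta)$ is obtained when $y_1\vee y_2=1$, i.e. restricting the infimum defining $F(H,\delta)$ to points with $\max(y_1,y_2)=1$ does not change its value. (b) Suppose in addition that $H$ is connected and $\Delta$-regular. If $n^{-2/\Delta}\ll p\ll 1$, then \[ \frac{\Phi_{n,p}(H,\delta)}{n^2p^\Delta\log(1/p)}\le \delta^{2/\mathsf{v}(H)}+o(1). \] Combined with part (a), when $n^{-1/\Delta}\ll p\ll 1$ this gives \[ \frac{\Phi_{n,p}(H,\delta)}{n^2p^\Delta\log(1/p)}\le \min\big(F(H,\delta),\delta^{2/\mathsf{v}(H)}\big)+o(1). \]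
   Context: A digraph $H=(\mathsf V,\mathsf E)$ has no self-loops and at most one directed edge $(u,v)$ for each ordered pair $(u,v)$; $\mathsf v(H)=|\mathsf V(H)|$, $\mathsf e(H)=|\mathsf E(H)|$. The degree of a vertex is the sum of its in-degree and out-degree; $\Delta$ is the maximum degree, and $H$ is $\Delta$-regular if every vertex has degree $\Delta$. $\mathcal Q_n$ is the set of $n\times n$ real matrices with zero diagonal and all entries in $[0,1]$. For $Q\in\mathcal Q_n$, $t(H,Q)=n^{-\mathsf v(H)}\sum_{\phi:\mathsf V(H)\to[n]}\prod_{(i,j)\in\mathsf E(H)}Q(\phi(i),\phi(j))$. For $x\in[0,1]$, $I_p(x)=x\log\frac xp+(1-x)\log\frac{1-x}{1-p}$ (with $0\log 0=0$), and $I_p(Q)=\sum_{i\ne j}I_p(Q(i,j))$. Define \[ \Phi_{n,p}(H,\delta)=\inf_{Q\in\mathcal Q_n}\{I_p(Q): t(H,Q)\ge(1+\delta)p^{\mathsf e(H)}\}. \] $H^*$ is the induced subgraph of $H$ on the vertices of degree $\Delta$, and $\mathcal S_H$ is the collection of all independent sets of $H^*$ (including the empty set). For $S\subseteq\mathsf V(H)$: $\mathsf N^+(S)$ is the set of $v\notin S$ with $(u,v)\in\mathsf E(H)$ for some $u\in S$; $\mathsf N^-(S)$ is the set of $v\notin S$ with $(v,u)\in\mathsf E(H)$ for some $u\in S$; $A_S=|\mathsf N^+(S)|$, $B_S=|\mathsf N^-(S)|$. Let $\mathsf v^+(S)$ be the number of vertices of $S$ having no in-neighbours in $H$, $\mathsf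 v^-(S)$ the number of vertices of $S$ having no out-neighbours in $H$, and $\mathsf v^{\pm}(S)$ the number of vertices of $S$ having both an in-neighbour and an out-neighbour. Set \[ f_H(x_1,x_2,y_1,y_2)=\sum_{S\in\mathcal S_H}x_1^{\mathsf v^+(S)}x_2^{\mathsf v^-(S)}(x_1\wedge x_2)^{\mathsf v^{\pm}(S)}y_1^{A_S}y_2^{B_S}, \] \[ F(H,\delta)=\inf_{x_1,x_2\ge0,\ 0\le y_1,y_2\le1}\{x_1y_1+x_2y_2: f_H(x_1,x_2,y_1,y_2)=1+\delta\}. \] Here $a\wedge b=\min(a,b)$, $a\vee b=\max(a,b)$, and $f\ll g$ means $f/g\to0$ as $n\to\infty$. *)

(* Defs.v *)
From HB Require Import structures.
From mathcomp Require Import all_boot all_order all_algebra.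
From mathcomp Require Import all_classical all_reals all_analysis.
Set Implicit Arguments. Unset Strict Implicit. Unset Printing Implicit Defensive.
Import Order.TTheory GRing.Theory Num.Theory.
Local Open Scope ring_scope.
Local Open Scope classical_set_scope.

(* A digraph H on vertex set 'I_k is given by an irreflexive relation E
   (E u v  <->  (u,v) is a directed edge).  A relation automatically has at
   most one edge per ordered pair. *)
Section Digraph.
Variables (k : nat) (E : rel 'I_k).

Definition indeg (v : 'I_k) : nat := #|[set u | E u v]|.
Definition outdeg (v : 'I_k) : nat := #|[set w | E v w]|.
Definition deg (v : 'I_k) : nat := indeg v + outdeg v.
Definition maxdeg : nat := \max_(v : 'I_k) deg v.
Definition nedges : nat := #|[set uv : 'I_k * 'I_k | E uv.1 uv.2]|.

Definition regular (D : nat) : Prop := forall v, deg v = D.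
Definition dconnected : Prop :=
  forall u v : 'I_k, connect (fun a b => E a b || E b a) u v.

Definition indepHstar (S : {set 'I_k}) : bool :=
  (S \subset [set v | deg v == maxdeg]) &&
  [forall u in S, forall v in S, ~~ E u v].

Definition Nplus (S : {set 'I_k}) : {set 'I_k} :=
  [set v | (v \notin S) && [exists u in S, E u v]].
Definition Nminus (S : {set 'I_k}) : {set 'I_k} :=
  [set v | (v \notin S) && [exists u in S, E v u]].
Definition A_S (S : {set 'I_k}) : nat := #|Nplus S|.
Definition B_S (S : {set 'I_k}) : nat := #|Nminus S|.
Definition vplus (S : {set 'I_k}) : nat := #|[set v in S | indeg v == 0%N]|.
Definition vminus (S : {set 'I_k}) : nat := #|[set v in S | outdeg v == 0%N]|.
Definition vpm (S : {set 'I_k}) : nat :=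
  #|[set v in S | (0 < indeg v)%N && (0 < outdeg v)%N]|.

Variable R : realType.

Definition fH (x1 x2 y1 y2 : R) : R :=
  \sum_(S : {set 'I_k} | indepHstar S)
     x1 ^+ vplus S * x2 ^+ vminus S * (Num.min x1 x2) ^+ vpm S
     * y1 ^+ A_S S * y2 ^+ B_S S.

Definition FH (delta : R) : \bar R :=
  ereal_inf [set r : \bar R | exists x1 x2 y1 y2 : R,
    [/\ 0 <= x1, 0 <= x2, 0 <= y1 <= 1, 0 <= y2 <= 1
      & fH x1 x2 y1 y2 = 1 + delta] /\ r = (x1 * y1 + x2 * y2)%:E].

Definition FH_max1 (delta : R) : \bar R :=
  ereal_inf [set r : \bar R | exists x1 x2 y1 y2 : R,
    [/\ 0 <= x1, 0 <= x2, 0 <= y1 <= 1, 0 <= y2 <= 1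
      & fH x1 x2 y1 y2 = 1 + delta] /\ Num.max y1 y2 = 1
      /\ r = (x1 * y1 + x2 * y2)%:E].

Definition tdens (n : nat) (Q : 'M[R]_n) : R :=
  (n%:R ^- k) * \sum_(phi : {ffun 'I_k -> 'I_n})
     \prod_(u : 'I_k) \prod_(v : 'I_k | E u v) Q (phi u) (phi v).

Definition xlogxp (x p : R) : R := if x == 0 then 0 else x * ln (x / p).

Definition Ip (p x : R) : R := xlogxp x p + xlogxp (1 - x) (1 - p).

Definition IpQ (n : nat) (p : R) (Q : 'M[R]_n) : R :=
  \sum_(i : 'I_n) \sum_(j : 'I_n | i != j) Ip p (Q i j).

Definition Qclass (n : nat) (Q : 'M[R]_n) : Prop :=
  (forall i, Q i i = 0) /\ (forall i j, 0 <= Q i j <= 1).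

(* Phi_{n,p}(H, delta) (inf of the empty set is +oo) *)
Definition PhiH (n : nat) (p delta : R) : \bar R :=
  ereal_inf [set r : \bar R | exists Q : 'M[R]_n,
    [/\ Qclass Q, tdens Q >= (1 + delta) * p ^+ nedges & r = (IpQ p Q)%:E]].

End Digraph.

(* Main.v *)
(* The upper bounds come from planting all-ones blocks in the constant matrix p:
   an entry 1 costs log(1/p), an entry p costs nothing.  For (a), the rows of
   about x1 p^D n hubs are set to 1 on y1 n columns, and the columns of about
   x2 p^D n hubs are set to 1 on y2 n rows; the maps phi sending exactly the
   vertices of an independent set S of H^* to hubs contribute, after
   normalisation by p^e(H), the S-term of f_H.  For (b), a clique on about
   delta^(1/k) p^(D/2) n vertices contributes delta to the normalised density.
   The strict gain needed to absorb the lower-order losses is obtained by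
   slightly enlarging x1, x2, resp. the clique.  That the infimum may be taken
   over max(y1, y2) = 1 follows from |S| <= A_S + B_S: passing to (y x, y' / y)
   with y = max(y1, y2) keeps the cost and can only increase f_H, after which x
   can be scaled down. *)

Require Import Defs.
From HB Require Import structures.
From mathcomp Require Import all_boot all_order all_algebra.
From mathcomp Require Import all_classical all_reals all_analysis.
From mathcomp Require Import zify ring lra.
Set Implicit Arguments. Unset Strict Implicit. Unset Printing Implicit Defensive.
Import Order.TTheory GRing.Theory Num.Theory numFieldNormedType.Exports.
Local Open Scope ring_scope.

(** * Degree sums and edge counts around independent sets of [H^*] *)

Section Degrees.
Variables (k : nat) (E : rel 'I_k).

Lemma indegE v : indeg E v = (\sum_u E u v)%N.
Proof.
rewrite -[RHS]big_mkcond /indeg /outdeg -sum1_card; apply: eq_bigl => u.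
by apply/idP/idP; rewrite inE.
Qed.

Lemma outdegE v : outdeg E v = (\sum_u E v u)%N.
Proof.
rewrite -[RHS]big_mkcond /indeg /outdeg -sum1_card; apply: eq_bigl => u.
by apply/idP/idP; rewrite inE.
Qed.

Lemma nedgesE : nedges E = (\sum_u \sum_v E u v)%N.
Proof.
rewrite pair_big -[RHS]big_mkcond /nedges -sum1_card; apply: eq_bigl => u.
by apply/idP/idP; rewrite inE.
Qed.

Lemma handshake : (\sum_v deg E v = 2 * nedges E)%N.
Proof.
rewrite big_split /= nedgesE mul2n -addnn; congr addn.
  by rewrite [RHS]exchange_big; apply: eq_bigr => v _; rewrite indegE.
by apply: eq_bigr => v _; rewrite outdegE.
Qed.

Lemma leq_maxdeg v : (deg E v <= maxdeg E)%N.
Proof. exact: (leq_bigmax (F := deg E)). Qed.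

Lemma maxdeg_gt0_card : (0 < maxdeg E)%N -> (0 < k)%N.
Proof.
move=> D0; rewrite lt0n; apply: contraTneq D0 => k0.
rewrite -leqNgt; apply/bigmax_leqP => u _; have := ltn_ord u.
by rewrite [X in (_ < X)%N]k0.
Qed.

Lemma indep_deg S v : indepHstar E S -> v \in S -> deg E v = maxdeg E.
Proof. by case/andP=> /fintype.subsetP sub _ /sub; rewrite inE => /eqP. Qed.

Lemma indep_edge S u v : indepHstar E S -> u \in S -> E u v -> v \notin S.
Proof.
case/andP=> _ /forall_inP ind uS Euv; apply/negP => vS.
by have /forall_inP /(_ _ vS) := ind _ uS; rewrite Euv.
Qed.

Lemma indep0 : indepHstar E finset.set0.
Proof.
apply/andP; split; first by apply/fintype.subsetP => u; rewrite finset.inE.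
by apply/forall_inP => u; rewrite finset.inE.
Qed.

Lemma sum_deg_indep S : indepHstar E S ->
  (\sum_(v in S) deg E v = #|S| * maxdeg E)%N.
Proof.
by move=> iS; rewrite -sum_nat_const; apply: eq_bigr => v; apply: indep_deg.
Qed.

(** No edge has both ends in [S], so each edge meeting [S] is counted exactly once by the degrees of
    [S], all of them maximal. This is how one factor [p ^+ maxdeg E] per hub completes the remaining
    edges to [p ^+ nedges E]. *)
Lemma nedges_indep S : indepHstar E S ->
  nedges E =
    (#|S| * maxdeg E + \sum_u \sum_v [&& E u v, u \notin S & v \notin S])%N.
Proof.
move=> iS; rewrite -(sum_deg_indep iS) nedgesE.
have -> : (\sum_(v in S) deg E v =
    \sum_u \sum_v (u \in S) * E u v + \sum_u \sum_v (v \in S) * E u v)%N.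
  have mulb (b : bool) m : (b * m = if b then m else 0)%N by case: b; rewrite ?mul1n.
  rewrite big_split /= [LHS]addnC; congr addn.
    rewrite big_mkcond; apply: eq_bigr => v _.
    by rewrite -mulb outdegE big_distrr.
  rewrite [RHS]exchange_big big_mkcond; apply: eq_bigr => v _.
  by rewrite -mulb indegE big_distrr.
rewrite -!big_split; apply: eq_bigr => u _ /=.
rewrite -!big_split; apply: eq_bigr => v _ /=.
case Euv: (E u v); last by rewrite !muln0.
have := @indep_edge S u v iS.
by case: (u \in S); case: (v \in S) => //; move/(_ isT Euv).
Qed.

Lemma Nplus_edge S u v : indepHstar E S -> u \in S -> E u v -> v \in Nplus E S.
Proof.
move=> iS uS Euv; rewrite inE (indep_edge iS uS Euv).
by apply/exists_inP; exists u.
Qed.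

Lemma Nminus_edge S u v : indepHstar E S -> v \in S -> E u v -> u \in Nminus E S.
Proof.
move=> iS vS Euv; rewrite inE; apply/andP; split; last by apply/exists_inP; exists v.
by apply/negP => uS; have := indep_edge iS uS Euv; rewrite vS.
Qed.

(* Double counting of the edges between [S] and its neighbourhood. *)
Lemma leq_card_neighbours S : (0 < maxdeg E)%N -> indepHstar E S ->
  (#|S| <= A_S E S + B_S E S)%N.
Proof.
move=> D0 iS; rewrite -(leq_pmul2r D0) -sum_deg_indep //.
pose N := Nplus E S :|: Nminus E S.
apply: (@leq_trans (\sum_(v in N) deg E v)); last first.
  apply: (@leq_trans (\sum_(v in N) maxdeg E)).
    by apply: leq_sum => v _; apply: leq_maxdeg.
  rewrite sum_nat_const leq_mul2r; apply/orP; right.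
  by rewrite cardsU leq_subr.
rewrite big_mkcond [leqRHS]big_mkcond /=.
have degE P : (\sum_v (if v \in P then deg E v else 0) =
    \sum_v \sum_u (v \in P) * (E u v + E v u))%N.
  apply: eq_bigr => v _; rewrite -big_distrr big_split /= /deg indegE outdegE.
  by case: (v \in P); rewrite ?mul1n ?mul0n.
rewrite !degE exchange_big.
(* The comparison is made pair by pair: an edge joining [v] in [S] to [u] forces [u] into [N]. *)
apply: leq_sum => u _; apply: leq_sum => v _ /=.
case vS: (v \in S) => //=; case uN: (u \in N) => /=.
  by rewrite addnC.
rewrite mul1n mul0n leqn0 addn_eq0 !eqb0.
apply/andP; split; apply/negP=> e; move/negbT: uN; rewrite finset.inE.
  by rewrite (Nminus_edge iS vS e) orbT.
by rewrite (Nplus_edge iS vS e).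
Qed.

End Degrees.

(* Greedy choice of the values, starting from the last coordinate. *)
Lemma leq_card_inj (T : finType) (c k : nat) (C : 'I_k -> {set T}) :
  (k <= c.+1)%N ->
  (\prod_u (#|C u| - c) <=
     #|[set f : {ffun 'I_k -> T} | injectiveb f && [forall u, f u \in C u]]%SET|)%N.
Proof.
elim: k C => [|k IH] C kc.
  rewrite big_ord0; apply/card_gt0P.
  exists (ffun0 (card_ord 0)); rewrite finset.inE; apply/andP; split; last by apply/forallP => -[].
  by apply/injectiveP => -[].
rewrite big_ord_recl.
pose F := [set f : {ffun 'I_k -> T} | injectiveb f &&
  [forall u, f u \in C (lift ord0 u)]]%SET.
(* The value at [ord0] has to avoid the [k] values of [f], that is at most [c] points, since
   [k.+1 <= c.+1]. *)
apply: (@leq_trans (\sum_(f in F) #|C ord0 :\: [set f u | u : 'I_k]%SET|)%N).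
  apply: (@leq_trans (\sum_(f in F) (#|C ord0| - c))%N).
    by rewrite sum_nat_const mulnC leq_mul2r IH ?orbT // ltnW.
  apply: leq_sum => f _; rewrite cardsD leq_sub2l //.
  apply: leq_trans (subset_leq_card (finset.subsetIr _ _)) _.
  by apply: leq_trans (leq_imset_card _ _) _; rewrite card_ord.
pose ext (q : {ffun 'I_k -> T} * T) : {ffun 'I_k.+1 -> T} :=
  [ffun i => if unlift ord0 i is Some j then q.1 j else q.2].
have ext0 q : ext q ord0 = q.2 by rewrite ffunE unlift_none.
have extS q j : ext q (lift ord0 j) = q.1 j by rewrite ffunE liftK.
have ext_inj : injective ext.
  move=> [f x] [g y] e; congr pair; last by have := ext0 (f, x); rewrite e ext0.
  by apply/ffunP => j; have := extS (f, x) j; rewrite e extS.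
pose P := [set q | (q.1 \in F) && (q.2 \in C ord0 :\: [set q.1 u | u : 'I_k]%SET)]%SET.
have -> : (\sum_(f in F) #|C ord0 :\: [set f u | u : 'I_k]%SET| = #|P|)%N.
  under eq_bigr do rewrite -sum1_card.
  rewrite pair_big_dep -sum1_card; apply: eq_bigl => q.
  by rewrite [in RHS]finset.inE.
rewrite -(card_imset _ ext_inj); apply: subset_leq_card.
apply/fintype.subsetP => _ /imsetP [[f x]] + ->.
rewrite !finset.inE /= => /andP [/andP [/injectiveP f_inj /forallP fC]].
case/andP => xf xC; apply/andP; split.
  apply/injectiveP => i j.
  case: (unliftP ord0 i) => [i'|] ->; case: (unliftP ord0 j) => [j'|] ->;
    rewrite ?ext0 ?extS //=.
  - by move/f_inj ->.
  - by move=> e; case/negP: xf; apply/imsetP; exists i'.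
  - by move=> e; case/negP: xf; apply/imsetP; exists j'.
apply/forallP => i; case: (unliftP ord0 i) => [i'|] ->; rewrite ?ext0 ?extS //=.
Qed.

Lemma card_ord_itv (n lo hi : nat) : (hi <= n)%N ->
  #|[set j : 'I_n | (lo <= j < hi)%N]%SET| = (hi - lo)%N.
Proof.
move=> hin; rewrite -sum1_card.
rewrite (eq_bigl (fun j : 'I_n => (j < hi) && (lo <= j))%N) => [|j]; last first.
  by rewrite finset.inE andbC.
rewrite -(big_mkord (fun j => (j < hi) && (lo <= j))%N (fun=> 1%N)).
rewrite -(big_nat_widenl lo 0 n (fun j => j < hi)%N) // -(big_nat_widen _ _ _ predT) //.
by rewrite sum_nat_const_nat muln1.
Qed.

(** * Cost and density of a constant matrix with planted ones *)

Section Planted.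
Context {R : realType}.
Implicit Types (p eta X : R).

Lemma Ip_self p : 0 < p < 1 -> Ip p p = 0.
Proof.
move=> /andP [p0 p1]; have q0 : 0 < 1 - p by rewrite subr_gt0.
by rewrite /Ip /xlogxp !gt_eqF // !divff ?gt_eqF // ln1 !mulr0 addr0.
Qed.

Lemma Ip_1 p : Ip p 1 = ln p^-1.
Proof. by rewrite /Ip /xlogxp oner_eq0 subrr eqxx addr0 !mul1r. Qed.

(** The zero diagonal is imposed by [Qclass]; it does no harm, as densities are bounded below
    through injective maps only. *)
Definition planted_mx n p (M : rel 'I_n) : 'M[R]_n :=
  \matrix_(i, j) if i == j then 0 else if M i j then 1 else p.

Lemma planted_mx_Qclass n p M : 0 < p < 1 -> Qclass (@planted_mx n p M).
Proof.
move=> /andP [p0 p1]; split=> [i|i j]; first by rewrite mxE eqxx.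
by rewrite mxE; case: (i == j); last case: (M i j); rewrite ?lexx ?ler01 ?(ltW p0) ?(ltW p1).
Qed.

(** Diagonal pairs in [M] enter the cardinal but cost nothing, hence an inequality. *)
Lemma IpQ_planted_mx n p (M : rel 'I_n) : 0 < p < 1 ->
  IpQ p (planted_mx p M) <= #|[set q : 'I_n * 'I_n | M q.1 q.2]%SET|%:R * ln p^-1.
Proof.
move=> p01; have lp0 : 0 <= ln p^-1.
  by case/andP: p01 => p0 p1; rewrite ln_ge0 // invf_ge1 // ltW.
rewrite -sum1_card natr_sum big_distrl /= (eq_bigl (fun q => M q.1 q.2)); last first.
  by move=> q; rewrite finset.inE.
rewrite big_mkcond -(pair_bigA _ (fun i j => if M i j then 1 * ln p^-1 else 0)) /=.
rewrite /IpQ; apply: ler_sum => i _; rewrite big_mkcond /=; apply: ler_sum => j _.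
rewrite mxE; case: (i == j) => /=; first by case: ifP; rewrite ?mul1r.
by case: ifP => _; rewrite ?Ip_1 ?mul1r // Ip_self.
Qed.

Lemma PhiH_le_planted k (E : rel 'I_k) n p (M : rel 'I_n) delta : 0 < p < 1 ->
  (1 + delta) * p ^+ nedges E <= tdens E (planted_mx p M) ->
  (PhiH E n p delta <=
    (#|[set q : 'I_n * 'I_n | M q.1 q.2]%SET|%:R * ln p^-1)%:E)%E.
Proof.
move=> p01 dens; apply: (@le_trans _ _ (IpQ p (planted_mx p M))%:E).
  apply: ereal_inf_lbound; exists (planted_mx p M); split => //.
  exact: planted_mx_Qclass.
by rewrite lee_fin IpQ_planted_mx.
Qed.

(** Truncation loses less than 1, which is the extra unit in [k.+1]. The alternative [X = 0] serves
    parameters of the construction that vanish, for which no largeness can be asked. *)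
Lemma truncn_sub_ge X eta (m k : nat) : 0 <= eta -> 0 <= X ->
  X = 0 \/ (m + k.+1)%:R <= eta * X ->
  (1 - eta) * X <= (Num.truncn X - m - k)%:R.
Proof.
move=> eta0 X0 [->|big]; first by rewrite mulr0.
have /andP [_] := truncn_itv X0; rewrite -natr1 => ltX.
have : (Num.truncn X)%:R <= (Num.truncn X - m - k)%:R + (m + k)%:R :> R.
  by rewrite -natrD ler_nat; lia.
by move: big; rewrite addnS -natr1; lra.
Qed.

(* [S] is recovered from [phi] as the set of the [u] with [phi u < m], so the
   profiles attached to different [S] do not overlap. *)
Lemma tdens_ge k (E : rel 'I_k) n (Q : 'M[R]_n) (P : pred {set 'I_k}) (m : nat)
    (h : {set 'I_k} -> 'I_k -> nat) (c : {set 'I_k} -> R) :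
  let lo (S : {set 'I_k}) u := (if u \in S then 0 else m)%N in
  (forall i j, 0 <= Q i j) ->
  (forall S, P S -> 0 <= c S) ->
  (forall S u, P S -> h S u <= n)%N ->
  (forall S u, P S -> u \in S -> h S u <= m)%N ->
  (forall S (phi : 'I_k -> 'I_n), P S -> injective phi ->
     (forall u, lo S u <= phi u < h S u)%N ->
     c S <= \prod_u \prod_(v | E u v) Q (phi u) (phi v)) ->
  n%:R ^- k * \sum_(S | P S) c S * \prod_u (h S u - lo S u - k)%:R <= tdens E Q.
Proof.
move=> lo Q0 c0 hn hm cQ; rewrite /tdens; apply: ler_wpM2l.
  by rewrite invr_ge0 exprn_ge0.
pose cell S u := [set j : 'I_n | (lo S u <= j < h S u)%N]%SET.
pose G S (phi : {ffun 'I_k -> 'I_n}) :=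
  injectiveb phi && [forall u, phi u \in cell S u].
apply: (@le_trans _ _ (\sum_(S | P S) c S * #|[set phi | G S phi]%SET|%:R)).
  apply: ler_sum => S PS; apply: ler_wpM2l; first exact: c0.
  rewrite -natr_prod ler_nat; apply: leq_trans (leq_card_inj _ (leqnSn k)).
  by apply: leq_prod => u _; rewrite card_ord_itv ?hn.
rewrite (eq_bigr (fun S => \sum_phi if G S phi then c S else 0)); last first.
  move=> S _; rewrite -sum1_card natr_sum big_distrr /= -big_mkcond.
  by apply: eq_big => [phi|phi _]; rewrite ?finset.inE ?mulr1.
rewrite exchange_big; apply: ler_sum => phi _ /=.
have prod0 : 0 <= \prod_u \prod_(v | E u v) Q (phi u) (phi v).
  by do 2!apply: prodr_ge0 => ? _.
pose S0 : {set 'I_k} := [set u | (phi u < m)%N]%SET.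
rewrite big_mkcond (bigD1 S0) //= big1 ?addr0.
  case: ifP => // PS0; case: ifP => // /andP [/injectiveP inj /forallP inc].
  by apply: (cQ S0) => // u; have := inc u; rewrite finset.inE.
move=> S neS; case: ifP => // PS; case: ifP => // /andP [_ /forallP inc].
case/eqP: neS; apply/setP => u; rewrite finset.inE.
have := inc u; rewrite finset.inE /lo; case: ifP => uS.
  by move/leq_trans => /(_ _ (hm _ _ PS uS)) ->.
by case/andP; rewrite leqNgt => /negbTE ->.
Qed.

(** The exponent of [p] that survives once every edge meeting [S] is mapped to an entry 1. *)
Definition edges_avoiding k (E : rel 'I_k) (S : {set 'I_k}) : nat :=
  \sum_u \sum_v [&& E u v, u \notin S & v \notin S].

(** Injectivity and irreflexivity keep the edges off the zero diagonal; an edge meeting [S] then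
    gives a factor 1, any other at least [p]. *)
Lemma prod_planted_mx_ge k (E : rel 'I_k) n p (M : rel 'I_n) (S : {set 'I_k})
    (phi : 'I_k -> 'I_n) :
  irreflexive E -> 0 < p < 1 -> injective phi ->
  (forall u v, E u v -> (u \in S) || (v \in S) -> M (phi u) (phi v)) ->
  p ^+ edges_avoiding E S <=
    \prod_u \prod_(v | E u v) planted_mx p M (phi u) (phi v).
Proof.
move=> E_irr /andP [p0 p1] inj MS.
rewrite /edges_avoiding expr_sum; apply: ler_prod => u _.
rewrite exprn_ge0 ?(ltW p0) //= expr_sum [X in _ <= X]big_mkcond /=; apply: ler_prod => v _.
rewrite exprn_ge0 ?(ltW p0) //=; case Euv: (E u v) => //=.
rewrite mxE (inj_eq inj); case: eqP => [uv|_]; first by rewrite uv E_irr in Euv.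
have := MS u v Euv; case: (u \in S) => /= [->//|]; rewrite ?expr0 //.
case: (v \in S) => /= [->//|_]; rewrite ?expr0 // expr1.
by case: ifP => // _; rewrite ltW.
Qed.

(** [X S u] is the real length prescribed for the range of [u] in profile [S]. Rounding it, dropping
    the indices below [lo S u] and enforcing injectivity cost at most a factor [1 - eta] per
    vertex. *)
Lemma tdens_planted_ge k (E : rel 'I_k) n p (M : rel 'I_n)
    (P : pred {set 'I_k}) (m : nat) (X : {set 'I_k} -> 'I_k -> R) eta :
  let lo (S : {set 'I_k}) u := (if u \in S then 0 else m)%N in
  irreflexive E -> 0 < p < 1 -> 0 <= eta <= 1 ->
  (forall S u, P S -> 0 <= X S u <= n%:R) ->
  (forall S u, P S -> u \in S -> Num.truncn (X S u) <= m)%N ->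
  (forall S u, P S -> X S u = 0 \/ (lo S u + k.+1)%:R <= eta * X S u) ->
  (forall S u v (i j : 'I_n), P S -> E u v -> (u \in S) || (v \in S) ->
     (lo S u <= i < Num.truncn (X S u))%N ->
     (lo S v <= j < Num.truncn (X S v))%N -> M i j) ->
  n%:R ^- k * (1 - eta) ^+ k *
    \sum_(S | P S) p ^+ edges_avoiding E S * \prod_u X S u
  <= tdens E (planted_mx p M).
Proof.
move=> lo E_irr p01 /andP [eta0 eta1] X01 Xm Xbig XM.
have /andP [p0 p1] := p01.
apply: le_trans (@tdens_ge k E n _ P m (fun S u => Num.truncn (X S u))
  (fun S => p ^+ edges_avoiding E S) _ _ _ _ _).
- rewrite -mulrA ler_wpM2l ?invr_ge0 ?exprn_ge0 // big_distrr /=.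
  apply: ler_sum => S PS; rewrite mulrCA ler_wpM2l ?exprn_ge0 ?(ltW p0) //.
  rewrite -[in (1 - eta) ^+ k](card_ord k) -prodr_const -big_split /=.
  apply: ler_prod => u _; have /andP [X0 _] := X01 S u PS.
  by rewrite mulr_ge0 ?subr_ge0 //= truncn_sub_ge //; apply: Xbig.
- by move=> i j; have [_ /(_ i j) /andP []] := planted_mx_Qclass M p01.
- by move=> S _; rewrite exprn_ge0 ?(ltW p0).
- move=> S u PS; have /andP [X0 Xn] := X01 S u PS.
  by rewrite -(natrK (R := R) n) le_truncn.
- exact: Xm.
- move=> S phi PS inj inc; apply: prod_planted_mx_ge => // u v Euv uvS.
  exact: (XM S u v _ _ PS Euv uvS (inc u) (inc v)).
Qed.

End Planted.

(** * The polynomial [fH]: scaling, normalisation and the second claim of (a) *)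

Section HubPolynomial.
Context {R : realType} (k : nat) (E : rel 'I_k).
Hypothesis Delta_pos : (0 < maxdeg E)%N.
Implicit Types (s x y : R) (S : {set 'I_k}).

(** The factor of a single vertex of [S] in [fH]; it turns the three counting exponents into one
    product over [S]. *)
Definition hub_weight (x1 x2 : R) (u : 'I_k) : R :=
  if indeg E u == 0 then x1 else if outdeg E u == 0 then x2 else Num.min x1 x2.

Definition hub_term (x1 x2 y1 y2 : R) S : R :=
  (\prod_(u in S) hub_weight x1 x2 u) * y1 ^+ A_S E S * y2 ^+ B_S E S.

Lemma hub_weight_ge0 (x1 x2 : R) u : 0 <= x1 -> 0 <= x2 -> 0 <= hub_weight x1 x2 u.
Proof.
move=> ? ?; rewrite /hub_weight; case: eqP => _ //; case: eqP => _ //.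
by rewrite le_min; apply/andP.
Qed.

Lemma hub_term_ge0 (x1 x2 y1 y2 : R) S : 0 <= x1 -> 0 <= x2 -> 0 <= y1 -> 0 <= y2 ->
  0 <= hub_term x1 x2 y1 y2 S.
Proof.
by move=> *; rewrite !mulr_ge0 ?exprn_ge0 ?prodr_ge0 // => u _; apply: hub_weight_ge0.
Qed.

(** A vertex of [S] has positive degree, so it is counted by exactly one of [vplus], [vminus] and
    [vpm]. *)
Lemma fHE (x1 x2 y1 y2 : R) :
  fH E x1 x2 y1 y2 = \sum_(S | indepHstar E S) hub_term x1 x2 y1 y2 S.
Proof.
apply: eq_bigr => S iS; congr (_ * _ * _).
have pow (P : pred 'I_k) x :
    x ^+ #|[set v in S | P v]%SET| = \prod_(v in S) if P v then x else 1.
  rewrite -prodr_const big_mkcond [RHS]big_mkcond; apply: eq_bigr => v _ /=.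
  by rewrite finset.inE; case: (v \in S).
rewrite /vplus /vminus /vpm !pow -!big_split; apply: eq_bigr => v vS /=.
rewrite /hub_weight; have := indep_deg iS vS; rewrite /deg => d.
case: (posnP (indeg E v)) d => [->|i0]; case: (posnP (outdeg E v)) => [->|o0] //=.
- by move=> d; have := Delta_pos; rewrite -d.
- by rewrite !mulr1.
- by rewrite !mulr1 mul1r.
- by rewrite !mul1r.
Qed.

Lemma hub_term0 (x1 x2 y1 y2 : R) : hub_term x1 x2 y1 y2 finset.set0 = 1.
Proof.
rewrite /hub_term big_set0 /A_S /B_S.
have -> : Nplus E finset.set0 = finset.set0.
  apply/setP => v; rewrite !finset.inE; apply/existsP => -[u].
  by rewrite finset.inE.
have -> : Nminus E finset.set0 = finset.set0.
  apply/setP => v; rewrite !finset.inE; apply/existsP => -[u].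
  by rewrite finset.inE.
by rewrite cards0 !mulr1.
Qed.

Lemma fHE1 (x1 x2 y1 y2 : R) : fH E x1 x2 y1 y2 =
  1 + \sum_(S | indepHstar E S && (S != finset.set0)) hub_term x1 x2 y1 y2 S.
Proof. by rewrite fHE (bigD1 finset.set0) ?indep0 //= hub_term0. Qed.

Lemma hub_term_scale s (x1 x2 y1 y2 : R) S : 0 <= s ->
  hub_term (s * x1) (s * x2) y1 y2 S = s ^+ #|S| * hub_term x1 x2 y1 y2 S.
Proof.
move=> s0; rewrite /hub_term !mulrA; do 2!congr (_ * _).
rewrite -prodr_const -big_split; apply: eq_bigr => u _ /=.
by rewrite /hub_weight -minr_pMr //; case: eqP => _ //; case: eqP.
Qed.

(** The empty set gives the constant 1, and every other term is multiplied by [s ^+ #|S|], which is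
    at least [s]. This is the source of the strict gain in the hub bound. *)
Lemma fH_scale_ge s (x1 x2 y1 y2 : R) : 1 <= s ->
  0 <= x1 -> 0 <= x2 -> 0 <= y1 -> 0 <= y2 ->
  1 + s * (fH E x1 x2 y1 y2 - 1) <= fH E (s * x1) (s * x2) y1 y2.
Proof.
move=> s1 x10 x20 y10 y20; rewrite !fHE1 lerD2l addrAC subrr add0r.
rewrite big_distrr /=; apply: ler_sum => S /andP [_ S0].
rewrite hub_term_scale ?(le_trans ler01) // ler_wpM2r ?hub_term_ge0 //.
by rewrite -[leLHS]expr1 ler_weXn2l // card_gt0.
Qed.

(** The term is multiplied by [y ^+ #|S| / y ^+ (A_S E S + B_S E S)], at least 1 because
    [#|S| <= A_S E S + B_S E S] and [y <= 1]. *)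
Lemma hub_term_normalize y (x1 x2 y1 y2 : R) S : indepHstar E S -> 0 < y <= 1 ->
  0 <= x1 -> 0 <= x2 -> 0 <= y1 -> 0 <= y2 ->
  hub_term x1 x2 y1 y2 S <= hub_term (y * x1) (y * x2) (y1 / y) (y2 / y) S.
Proof.
move=> iS /andP [y0 yle1] x10 x20 y10 y20; rewrite hub_term_scale ?(ltW y0) //.
rewrite /hub_term !expr_div_n.
set a := \prod_(u in S) _; set b := _ ^+ A_S _ _; set c := _ ^+ B_S _ _.
have -> : y ^+ #|S| * (a * (b / y ^+ A_S E S) * (c / y ^+ B_S E S)) =
  (y ^+ #|S| / y ^+ (A_S E S + B_S E S)) * (a * b * c).
  by rewrite exprD invfM; ring.
rewrite ler_peMl ?mulr_ge0 ?exprn_ge0 ?prodr_ge0 //.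
  by move=> u _; apply: hub_weight_ge0.
by rewrite ler_pdivlMr ?exprn_gt0 // mul1r ler_wiXn2l ?(ltW y0) // leq_card_neighbours.
Qed.

(** Along the segment from the origin to [(x1, x2)] the value is a polynomial in [s], equal to 1 at
    [s = 0]; the intermediate value theorem applies. *)
Lemma fH_downscale (x1 x2 y1 y2 c : R) : 0 <= x1 -> 0 <= x2 ->
  1 <= c <= fH E x1 x2 y1 y2 ->
  exists2 s : R, 0 <= s <= 1 & fH E (s * x1) (s * x2) y1 y2 = c.
Proof.
move=> x10 x20 /andP [c1 cf].
pose g s := \sum_(S | indepHstar E S) s ^+ #|S| * hub_term x1 x2 y1 y2 S.
have gE s : 0 <= s -> g s = fH E (s * x1) (s * x2) y1 y2.
  by move=> s0; rewrite fHE; apply: eq_bigr => S _; rewrite hub_term_scale.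
have g0 : g 0 = 1.
  rewrite /g (bigD1 finset.set0) ?indep0 //= cards0 hub_term0 mulr1 big1 ?addr0 //.
  by move=> S /andP [_ S0]; rewrite expr0n cards_eq0 (negbTE S0) mul0r.
have g1 : g 1 = fH E x1 x2 y1 y2 by rewrite gE // !mul1r.
have gc : continuous g.
  pose q : {poly R} :=
    \sum_(S | indepHstar E S) hub_term x1 x2 y1 y2 S *: 'X^#|S|.
  have -> : g = horner q.
    apply/funext => s; rewrite /q horner_sum; apply: eq_bigr => S _.
    by rewrite hornerZ hornerXn mulrC.
  exact: continuous_horner.
have [s s01 gs] : exists2 s, s \in `[0, 1]%R & g s = c.
  apply: IVT => //; first exact: continuous_subspaceT.
  by rewrite g0 g1 min_l ?max_r ?c1 ?cf // (le_trans c1 cf).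
exists s; first by move: s01; rewrite in_itv.
by rewrite -gE //; move: s01; rewrite in_itv => /andP [].
Qed.

Lemma FH_eq_FH_max1 (delta : R) : 0 < delta -> FH E delta = FH_max1 E delta.
Proof.
move=> d0; apply/eqP; rewrite eq_le; apply/andP; split.
  apply: ereal_inf_le_tmp => _ /= [x1 [x2 [y1 [y2 [adm [_ ->]]]]]].
  by exists x1, x2, y1, y2.
apply: le_ereal_inf_tmp => _ /= [x1 [x2 [y1 [y2 [[x10 x20 y101 y201 f] ->]]]]].
have /andP [y10 y11] := y101; have /andP [y20 y21] := y201.
pose y := Num.max y1 y2.
(* If [y1] and [y2] both vanished, every nonempty [S] would contribute 0, since [A_S E S + B_S E S]
   is positive; then [fH] would be 1, against [0 < delta]. *)
have y0 : 0 < y.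
  rewrite lt_neqAle le_max y10 andbT eq_sym; apply/negP => /eqP ye.
  have y1e : y1 = 0 by apply/eqP; rewrite eq_le y10 -ye le_max lexx.
  have y2e : y2 = 0 by apply/eqP; rewrite eq_le y20 -ye le_max lexx orbT.
  move: f; rewrite y1e y2e fHE1 big1 ?addr0 => [|S /andP [iS S0]]; first lra.
  rewrite /hub_term -mulrA -exprD expr0n.
  have := leq_card_neighbours Delta_pos iS; rewrite -card_gt0 in S0.
  by move/(leq_trans S0); rewrite lt0n => /negbTE ->; rewrite mulr0.
have yle1 : y <= 1 by rewrite ge_max y11.
have cf : 1 <= 1 + delta <= fH E (y * x1) (y * x2) (y1 / y) (y2 / y).
  rewrite lerDl (ltW d0) -f !fHE; apply: ler_sum => S iS.
  by rewrite hub_term_normalize ?y0.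
have [||s /andP [s0 s1] fs] := fH_downscale _ _ cf.
- by rewrite mulr_ge0 // ltW.
- by rewrite mulr_ge0 // ltW.
(* The factor [y] cancels in the cost, which is thus only multiplied by [s <= 1]. *)
apply: (@le_trans _ _ (s * (y * x1) * (y1 / y) + s * (y * x2) * (y2 / y))%:E).
  apply: ereal_inf_lbound; exists (s * (y * x1)), (s * (y * x2)), (y1 / y), (y2 / y).
  split; last first.
    split => //; rewrite -maxr_pMl ?invr_ge0 ?(ltW y0) // divff //.
    by rewrite gt_eqF.
  split => //.
  - by rewrite !mulr_ge0 // ltW.
  - by rewrite !mulr_ge0 // ltW.
  - by rewrite divr_ge0 ?(ltW y0) //= ler_pdivrMr // mul1r le_max lexx.
  - by rewrite divr_ge0 ?(ltW y0) //= ler_pdivrMr // mul1r le_max lexx orbT.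
have -> : s * (y * x1) * (y1 / y) + s * (y * x2) * (y2 / y) = s * (x1 * y1 + x2 * y2).
  by field; rewrite gt_eqF.
by rewrite lee_fin ler_piMl // addr_ge0 // mulr_ge0.
Qed.

End HubPolynomial.

(** * The hub construction at fixed [n] *)

Section HubConstruction.
Context {R : realType} (k : nat) (E : rel 'I_k).
Hypothesis E_irr : irreflexive E.
Hypothesis Delta_pos : (0 < maxdeg E)%N.
Variables (n : nat) (p eta x1 x2 y1 y2 : R).
Hypotheses (n_gt0 : (0 < n)%N) (p01 : 0 < p < 1) (eta01 : 0 <= eta <= 1).
Hypotheses (x1_ge0 : 0 <= x1) (x2_ge0 : 0 <= x2).
Hypotheses (y101 : 0 <= y1 <= 1) (y201 : 0 <= y2 <= 1).

Let L : R := p ^+ maxdeg E * n%:R.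
Let a1 := Num.truncn (x1 * L).
Let a2 := Num.truncn (x2 * L).
Let b1 := Num.truncn (y1 * n%:R).
Let b2 := Num.truncn (y2 * n%:R).
Let m := maxn a1 a2.

(* The hubs are the indices below [m], and the two hub sets are nested because
   a vertex with both in- and out-neighbours contributes [min x1 x2]. *)
Definition hub_rel (i j : 'I_n) : bool :=
  (i < a1)%N && (m <= j < b1)%N || (m <= i < b2)%N && (j < a2)%N.

Let y10 : 0 <= y1. Proof. by case/andP: y101. Qed.
Let y11 : y1 <= 1. Proof. by case/andP: y101. Qed.
Let y20 : 0 <= y2. Proof. by case/andP: y201. Qed.
Let y21 : y2 <= 1. Proof. by case/andP: y201. Qed.
Let p0 : 0 < p. Proof. by case/andP: p01. Qed.
Let L0 : 0 <= L. Proof. by rewrite mulr_ge0 ?exprn_ge0 ?(ltW p0). Qed.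

Lemma card_hub_rel :
  #|[set q : 'I_n * 'I_n | hub_rel q.1 q.2]%SET|%:R
    <= (x1 * y1 + x2 * y2) * (L * n%:R).
Proof.
pose I lo hi : {set 'I_n} := [set i : 'I_n | (lo <= i < hi)%N]%SET.
have cardI lo hi : (#|I lo hi| <= hi)%N.
  have [hin|nhi] := leqP hi n; first by rewrite card_ord_itv // leq_subr.
  by apply: leq_trans (max_card _) _; rewrite card_ord ltnW.
apply: (@le_trans _ _ (a1 * b1 + b2 * a2)%:R).
  rewrite ler_nat; apply: (@leq_trans
    #|finset.setX (I 0%N a1) (I m b1) :|: finset.setX (I m b2) (I 0%N a2)|).
    by apply: subset_leq_card; apply/fintype.subsetP => -[i j]; rewrite !finset.inE.
  apply: leq_trans (leq_card_setU _ _) _.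
  by rewrite !cardsX leq_add // leq_mul.
have tr (z : R) : 0 <= z -> (Num.truncn z)%:R <= z.
  by move=> z0; rewrite truncn_le.
rewrite natrD !natrM.
have -> : (x1 * y1 + x2 * y2) * (L * n%:R) =
  x1 * L * (y1 * n%:R) + y2 * n%:R * (x2 * L) by ring.
by apply: lerD; apply: ler_pM => //; apply: tr; rewrite mulr_ge0.
Qed.

(** Conditions met for all large [n]: hub ranges fit into [n], and the losses by rounding,
    injectivity and removal of the first [m] indices are absorbed by [eta]. The entry 1 in [y_big]
    is for vertices outside [S] without neighbours in [S]. *)
Hypothesis x_le : forall x, x \in [:: x1; x2] -> x * p ^+ maxdeg E <= 1.
Hypothesis x_big :
  forall x, x \in [:: x1; x2] -> x = 0 \/ k.+1%:R <= eta * (x * L).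
Hypothesis y_big :
  forall y, y \in [:: 1; y1; y2] -> y = 0 \/ (m + k.+1)%:R <= eta * (y * n%:R).

(* The two column and row blocks are nested as well, so their intersection has
   relative size [min y1 y2], which is at least the [y1 * y2] of [fH]. *)
Let nbr_weight (S : {set 'I_k}) (u : 'I_k) : R :=
  Num.min (if u \in Nplus E S then y1 else 1) (if u \in Nminus E S then y2 else 1).

Let X (S : {set 'I_k}) (u : 'I_k) : R :=
  if u \in S then hub_weight E x1 x2 u * L else nbr_weight S u * n%:R.

Let hub_weight_mem u : hub_weight E x1 x2 u \in [:: x1; x2].
Proof.
rewrite !inE /hub_weight; case: (indeg E u == 0)%N; first by rewrite eqxx.
case: (outdeg E u == 0)%N; first by rewrite eqxx orbT.
by rewrite minEle; case: ifP; rewrite eqxx ?orbT.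
Qed.

Let hub_weight_out u : outdeg E u != 0%N -> hub_weight E x1 x2 u <= x1.
Proof.
rewrite /hub_weight => /negbTE ->; case: eqP => // _.
by rewrite ge_min lexx.
Qed.

Let hub_weight_in u : indeg E u != 0%N -> hub_weight E x1 x2 u <= x2.
Proof.
rewrite /hub_weight => /negbTE ->; case: eqP => // _.
by rewrite ge_min lexx orbT.
Qed.

Let nbr_weight_mem S u : nbr_weight S u \in [:: 1; y1; y2].
Proof.
rewrite /nbr_weight minEle.
case: (u \in Nplus E S); case: (u \in Nminus E S);
  by case: (_ <= _); rewrite !inE eqxx ?orbT.
Qed.

Let nbr_weight01 S u : 0 <= nbr_weight S u <= 1.
Proof.
have := nbr_weight_mem S u; rewrite !inE => /or3P [] /eqP -> //.
by rewrite ler01 lexx.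
Qed.

Let X_ge S : indepHstar E S ->
  hub_term E x1 x2 y1 y2 S * p ^+ (#|S| * maxdeg E) * n%:R ^+ k <= \prod_u X S u.
Proof.
move=> iS; rewrite /hub_term /A_S /B_S mulnC exprM.
rewrite -!prodr_const -[k in n%:R ^+ k](card_ord k) -[n%:R ^+ _]prodr_const.
(* All products are extended by factors 1 to the whole vertex set, so that they can be compared
   vertex by vertex. *)
rewrite (big_mkcond (fun u => u \in S) (hub_weight E x1 x2)) /=.
rewrite (big_mkcond (fun u => u \in Nplus E S)) /=.
rewrite (big_mkcond (fun u => u \in Nminus E S)) /=.
rewrite (big_mkcond (fun u => u \in S) (fun=> p ^+ _)) /=.
rewrite -!big_split /=; apply: ler_prod => u _; rewrite /X /nbr_weight.
have hw0 := hub_weight_ge0 E u x1_ge0 x2_ge0.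
have pD0 : 0 <= p ^+ maxdeg E by rewrite exprn_ge0 ?(ltW p0).
apply/andP; split.
  by rewrite !mulr_ge0 //; case: (u \in _).
case uS: (u \in S).
  by rewrite !finset.inE uS /= !mulr1 mulrA.
rewrite mulr1 ler_wpM2r // mul1r le_min; apply/andP; split.
  by rewrite ler_piMr //; case: (u \in _).
by rewrite ler_piMl //; case: (u \in _).
Qed.

Lemma tdens_hub_rel :
  (1 - eta) ^+ k * (p ^+ nedges E * fH E x1 x2 y1 y2)
    <= tdens E (planted_mx p hub_rel).
Proof.
have n0 : 0 < n%:R :> R by rewrite ltr0n.
have eta1 : 0 <= 1 - eta by rewrite subr_ge0; case/andP: eta01.
apply: le_trans (@tdens_planted_ge _ k E n p hub_rel (indepHstar E) m X eta
  E_irr p01 eta01 _ _ _ _).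
- rewrite fHE // mulrAC -[leRHS]mulrC ler_wpM2l ?exprn_ge0 //.
  rewrite ler_pdivlMl ?exprn_gt0 // !big_distrr /=; apply: ler_sum => S iS.
  rewrite (nedges_indep iS) exprD mulrCA.
  rewrite -mulrA [X in X <= _](_ : _ = p ^+ edges_avoiding E S *
    (hub_term E x1 x2 y1 y2 S * p ^+ (#|S| * maxdeg E) * n%:R ^+ k)); last by ring.
  by rewrite ler_wpM2l ?exprn_ge0 ?(ltW p0) // X_ge.
- move=> S u _; rewrite /X; case: ifP => _.
    rewrite mulr_ge0 ?hub_weight_ge0 //= /L mulrA ler_piMl //.
    exact/x_le/hub_weight_mem.
  by have /andP [? ?] := nbr_weight01 S u; rewrite mulr_ge0 //= ler_piMl.
- move=> S u _ uS; rewrite /X uS leq_max.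
  by have := hub_weight_mem u; rewrite !inE => /orP [] /eqP ->; rewrite leqnn ?orbT.
- move=> S u _; rewrite /X; case: ifP => _.
    rewrite add0n; have [->|?] := x_big (hub_weight_mem u); last by right.
    by left; rewrite mul0r.
  have [->|?] := y_big (nbr_weight_mem S u); last by right.
  by left; rewrite mul0r.
(* If [u] is a hub, then [v] is in [Nplus E S], so its image is a column between [m] and [b1]; as
   [u] has an out-neighbour, its weight is at most [x1] and its image is a row below [a1]. The case
   of a hub [v] is symmetric. *)
move=> S u v i j iS Euv.
have out0 : outdeg E u != 0%N.
  by rewrite outdegE (bigD1 v) //= Euv.
have in0 : indeg E v != 0%N.
  by rewrite indegE (bigD1 u) //= Euv.
rewrite /X /hub_rel; case uS: (u \in S) => /=.
  move=> _ /= iu; rewrite (negbTE (indep_edge iS uS Euv)) => /andP [mj jv].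
  apply/orP; left; rewrite mj (leq_trans iu) ?(leq_trans jv) // le_truncn //.
    by rewrite ler_wpM2r // /nbr_weight (Nplus_edge iS uS Euv) ge_min lexx.
  by rewrite ler_wpM2r // hub_weight_out.
move=> vS /=; rewrite vS => /andP [mi iu] /= jv.
apply/orP; right; rewrite mi (leq_trans iu) ?(leq_trans jv) // le_truncn //.
  by rewrite ler_wpM2r // hub_weight_in.
by rewrite ler_wpM2r // /nbr_weight (Nminus_edge iS vS Euv) ge_min lexx orbT.
Qed.

End HubConstruction.

(** * The clique construction at fixed [n] *)

Section CliqueConstruction.
Context {R : realType} (k : nat) (E : rel 'I_k).
Hypothesis E_irr : irreflexive E.
Hypothesis Delta_pos : (0 < maxdeg E)%N.
Hypothesis E_reg : regular E (maxdeg E).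
Variables (n : nat) (p eta w : R).
Hypotheses (n_gt0 : (0 < n)%N) (p01 : 0 < p < 1) (eta01 : 0 <= eta <= 1).
Hypothesis w_ge0 : 0 <= w.

(** The power of [Num.sqrt p] encodes [p] to the exponent [maxdeg E / 2] with natural exponents
    only. *)
Let a : R := w * Num.sqrt p ^+ maxdeg E * n%:R.

Definition clique_rel (i j : 'I_n) : bool :=
  (i < Num.truncn a)%N && (j < Num.truncn a)%N.

Let a_ge0 : 0 <= a.
Proof. by rewrite !mulr_ge0 ?exprn_ge0 ?sqrtr_ge0. Qed.

Lemma card_clique_rel :
  #|[set q : 'I_n * 'I_n | clique_rel q.1 q.2]%SET|%:R
    <= w ^+ 2 * (n%:R ^+ 2 * p ^+ maxdeg E).
Proof.
have p0 : 0 <= p by case/andP: p01 => /ltW.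
pose I : {set 'I_n} := [set i : 'I_n | (0 <= i < Num.truncn a)%N]%SET.
have cardI : (#|I| <= Num.truncn a)%N.
  have [hin|nhi] := leqP (Num.truncn a) n; first by rewrite card_ord_itv // leq_subr.
  by apply: leq_trans (max_card _) _; rewrite card_ord ltnW.
apply: (@le_trans _ _ (Num.truncn a * Num.truncn a)%:R).
  rewrite ler_nat; apply: (@leq_trans #|finset.setX I I|).
    by apply: subset_leq_card; apply/fintype.subsetP => -[i j]; rewrite !finset.inE.
  by rewrite cardsX leq_mul.
have -> : w ^+ 2 * (n%:R ^+ 2 * p ^+ maxdeg E) = a * a.
  by rewrite -[in LHS](sqr_sqrtr p0) /a -exprM mulnC exprM; ring.
by rewrite natrM ler_pM // truncn_le.
Qed.

Hypothesis a_le : w * Num.sqrt p ^+ maxdeg E <= 1.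
Hypothesis a_big : k.+1%:R <= eta * a.
Hypothesis n_big : (Num.truncn a + k.+1)%:R <= eta * n%:R.

(** Two profiles are used: no vertex in the clique, giving 1, and all vertices in it, giving
    [w ^+ k]. By regularity and the handshake identity, [k] factors [Num.sqrt p ^+ maxdeg E]
    multiply to [p ^+ nedges E]. *)
Lemma tdens_clique_rel :
  (1 - eta) ^+ k * (p ^+ nedges E * (1 + w ^+ k))
    <= tdens E (planted_mx p clique_rel).
Proof.
have p0 : 0 <= p by case/andP: p01 => /ltW.
have n0 : 0 < n%:R :> R by rewrite ltr0n.
have eta1 : 0 <= 1 - eta by rewrite subr_ge0; case/andP: eta01.
pose P (S : {set 'I_k}) := (S == finset.set0) || (S == [set: 'I_k]%SET).
pose X (S : {set 'I_k}) (u : 'I_k) : R := if u \in S then a else n%:R.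
have T0 : [set: 'I_k]%SET != finset.set0.
  by rewrite -card_gt0 cardsT card_ord (maxdeg_gt0_card Delta_pos).
apply: le_trans (@tdens_planted_ge _ k E n p clique_rel P (Num.truncn a) X eta
  E_irr p01 eta01 _ _ _ _).
- rewrite mulrAC -[leRHS]mulrC ler_wpM2l ?exprn_ge0 // ler_pdivlMl ?exprn_gt0 //.
  rewrite (bigD1 finset.set0) /P ?eqxx //= (bigD1 [set: 'I_k]%SET) /=; last first.
    by rewrite T0 eqxx orbT.
  rewrite [X in _ + (_ + X)]big1 ?addr0; last first.
    by move=> S /andP [] /andP [] /orP [] /eqP ->; rewrite eqxx.
  have -> : edges_avoiding E finset.set0 = nedges E.
    by rewrite (nedges_indep (indep0 E)) cards0.
  have -> : edges_avoiding E [set: 'I_k]%SET = 0%N.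
    by rewrite /edges_avoiding big1 // => u _; rewrite big1 // => v _;
      rewrite !finset.inE andbF.
  rewrite (eq_bigr (fun=> n%:R)) => [|u _]; last by rewrite /X finset.inE.
  rewrite [X in _ <= _ + _ * X](eq_bigr (fun=> a)) => [|u _]; last first.
    by rewrite /X finset.inE.
  rewrite !prodr_const card_ord expr0 mul1r /a !exprMn -exprM.
  have -> : (maxdeg E * k = 2 * nedges E)%N.
    rewrite -handshake (eq_bigr (fun=> maxdeg E)) => [|u _]; last exact: E_reg.
    by rewrite sum_nat_const card_ord mulnC.
  by rewrite exprM sqr_sqrtr // le_eqVlt; apply/orP; left; apply/eqP; ring.
- move=> S u _; rewrite /X; case: ifP => _; last by rewrite ler0n lexx.
  by rewrite a_ge0 /a ler_piMl.
- by move=> S u _ uS; rewrite /X uS.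
- by move=> S u _; rewrite /X; case: ifP => _; right; rewrite ?add0n.
move=> S u v i j; rewrite /P => /orP [] /eqP ->; rewrite ?finset.inE //.
by rewrite /X /clique_rel !finset.inE /= => _ _ -> ->.
Qed.

End CliqueConstruction.

Local Open Scope classical_set_scope.

(** * Passage to large [n] *)

Section Asymptotics.
Context {R : realType}.

Lemma bernoulli_lb (x : R) k : 0 <= x <= 1 -> 1 - k%:R * x <= (1 - x) ^+ k.
Proof.
move=> /andP [x0 x1]; elim: k => [|k IH]; first by rewrite expr0 mul0r subr0.
rewrite exprS; apply: le_trans (ler_wpM2l _ IH); last by rewrite subr_ge0.
have : 0 <= k%:R * x * x by rewrite !mulr_ge0.
by rewrite -natr1; lra.
Qed.

(** By Bernoulli, [(1 - eta) ^+ k] is at least [1 - k%:R * eta], which exceeds [b / c] for the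
    chosen [eta]. Dividing by [k.+1] keeps the denominator positive for [k = 0]. *)
Lemma exists_loss k (b c : R) : 0 < b -> b < c ->
  exists2 eta : R, 0 < eta <= 1 & b <= (1 - eta) ^+ k * c.
Proof.
move=> b0 bc; have c0 := lt_trans b0 bc.
have k1 : 0 < k.+1%:R :> R by rewrite ltr0n.
pose eta := (1 - b / c) / k.+1%:R.
have bc0 : 0 < b / c by rewrite divr_gt0.
have bc1 : b / c < 1 by rewrite ltr_pdivrMr // mul1r.
have etak : eta * k.+1%:R = 1 - b / c by rewrite divfK ?gt_eqF.
have eta0 : 0 < eta by rewrite divr_gt0 // subr_gt0.
have eta1 : eta <= 1.
  by rewrite ler_pdivrMr // mul1r -natr1; have : 0 <= k%:R :> R by []; lra.
exists eta; first by rewrite eta0.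
rewrite -ler_pdivrMr //; apply: le_trans (bernoulli_lb _ _); last by rewrite ltW.
by move: etak; rewrite -natr1; lra.
Qed.

Lemma near_norm_lt (f : nat -> R) (e : R) : f @ \oo --> 0 -> 0 < e ->
  \forall n \near \oo, `|f n| < e.
Proof.
move/cvgrPdist_lt => + e0; move=> /(_ _ e0); apply: filterS => n.
by rewrite sub0r normrN.
Qed.

Variable p : nat -> R.
Hypothesis p01 : forall n, 0 < p n < 1.

(** The limit hypothesis bounds the power of [n] by [p n / C'] eventually; raising this to the power
    [d] clears the fractional exponent. *)
Lemma near_growth (d j : nat) : (0 < d)%N ->
  (fun n => powR n%:R (- (j%:R / d%:R)) / p n) @ \oo --> 0 ->
  forall C : R, \forall n \near \oo, C <= p n ^+ d * n%:R ^+ j.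
Proof.
(* With [C' >= 1], the power [C' ^+ d] obtained at the end still dominates [C]. *)
move=> d0 cv C; pose C' := Num.max 1 C.
have C'1 : 1 <= C' by rewrite le_max lexx.
have C'0 : 0 < C' by apply: lt_le_trans C'1.
have C'V : 0 < C'^-1 by rewrite invr_gt0.
near=> n.
have n0 : (0 < n)%N by near: n; exists 1%N.
have nR0 : 0 < n%:R :> R by rewrite ltr0n.
have /andP [p0 p1] := p01 n.
have : `|powR n%:R (- (j%:R / d%:R)) / p n| < C'^-1.
  by near: n; exact: (near_norm_lt cv).
rewrite ger0_norm ?divr_ge0 ?powR_ge0 ?(ltW p0) // ltr_pdivrMr // => lt_p.
apply: (@le_trans _ _ C'); first by rewrite le_max lexx orbT.
have := lerXn2r d _ _ (ltW lt_p); rewrite !nnegrE powR_ge0 mulr_ge0 ?(ltW p0) ?(ltW C'V) //.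
have -> : powR n%:R (- (j%:R / d%:R)) ^+ d = n%:R ^- j :> R.
  rewrite -powR_mulrn ?powR_ge0 // -powRrM mulNr divfK ?pnatr_eq0 -?lt0n //.
  by rewrite powRN powR_mulrn.
move=> /(_ isT isT); rewrite exprMn => le_p.
have nj0 : 0 < n%:R ^+ j :> R by rewrite exprn_gt0.
have : 1 <= C'^-1 ^+ d * p n ^+ d * n%:R ^+ j by rewrite -ler_pdivrMr // mul1r.
rewrite exprVn -mulrA ler_pdivlMl ?exprn_gt0 // mulr1; apply: le_trans.
by rewrite -[leLHS]expr1 ler_weXn2l.
Unshelve. all: by end_near. Qed.

Hypothesis p_to0 : p @ \oo --> 0.

Lemma near_small (C : R) : 0 < C -> \forall n \near \oo, p n <= C.
Proof.
move=> C0; near=> n; apply: ltW; apply: le_lt_trans (ler_norm _) _.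
near: n; exact: (near_norm_lt p_to0).
Unshelve. all: by end_near. Qed.

Variables (k : nat) (E : rel 'I_k).
Hypothesis E_irr : irreflexive E.
Hypothesis Delta_pos : (0 < maxdeg E)%N.
Local Notation D := (maxdeg E).

(** The strict gap above [1 + delta] fixes a loss [eta] independent of [n]; growth of
    [p n ^+ D * n%:R] makes the hub sets large, and [p n] tending to 0 makes them negligible against
    [n]. *)
Lemma hub_bound (x1 x2 y1 y2 delta : R) : 0 <= delta ->
  (forall C : R, \forall n \near \oo, C <= p n ^+ D * n%:R) ->
  0 <= x1 -> 0 <= x2 -> 0 <= y1 <= 1 -> 0 <= y2 <= 1 ->
  1 + delta < fH E x1 x2 y1 y2 ->
  \forall n \near \oo, (PhiH E n (p n) delta <=
    ((x1 * y1 + x2 * y2) * (n%:R ^+ 2 * p n ^+ D * ln (p n)^-1))%:E)%E.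
Proof.
move=> d0 growth x10 x20 y101 y201 f_gt.
have [eta /andP [eta0 eta1] etaf] := exists_loss k (ltr_pwDl ltr01 d0) f_gt.
have x12 : 0 < 1 + x1 + x2 by rewrite ltr_pwDl // ltr_pwDl.
have x_big x : 0 <= x ->
    \forall n \near \oo, x = 0 \/ k.+1%:R <= eta * (x * (p n ^+ D * n%:R)).
  rewrite le_eqVlt => /predU1P [<-|x0]; first by near=> n; left.
  near=> n; right; rewrite mulrA -ler_pdivrMl ?mulr_gt0 //.
  by near: n; exact: growth.
pose m n := maxn (Num.truncn (x1 * (p n ^+ D * n%:R)))
                 (Num.truncn (x2 * (p n ^+ D * n%:R))).
have pD n : p n ^+ D <= p n.
  by have /andP [? ?] := p01 n; rewrite -[leRHS]expr1 ler_wiXn2l // ltW.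
have y_big y : 0 <= y ->
    \forall n \near \oo, y = 0 \/ (m n + k.+1)%:R <= eta * (y * n%:R).
  rewrite le_eqVlt => /predU1P [<-|y0]; first by near=> n; left.
  near=> n; right; have /andP [p0 _] := p01 n.
  have L0 : 0 <= p n ^+ D * n%:R by rewrite mulr_ge0 ?exprn_ge0 ?(ltW p0).
  (* Half of [eta * y * n%:R] pays for [m n], the other half for [k.+1]. *)
  have small : p n <= eta * y / 2 / (1 + x1 + x2).
    by near: n; apply: near_small; rewrite !divr_gt0 ?mulr_gt0.
  have big : k.+1%:R <= eta * y / 2 * n%:R.
    rewrite -ler_pdivrMl ?divr_gt0 ?mulr_gt0 //.
    by near: n; exact: nbhs_infty_ger.
  have m_le : (m n)%:R <= eta * y / 2 * n%:R.
    apply: (@le_trans _ _ ((1 + x1 + x2) * (p n ^+ D * n%:R))).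
      rewrite /m; have [_|_] := leqP (Num.truncn (x1 * (p n ^+ D * n%:R))) _.
        apply: le_trans (_ : x2 * (p n ^+ D * n%:R) <= _).
          by rewrite truncn_le mulr_ge0.
        by rewrite ler_wpM2r //; lra.
      apply: le_trans (_ : x1 * (p n ^+ D * n%:R) <= _).
        by rewrite truncn_le mulr_ge0.
      by rewrite ler_wpM2r //; lra.
    rewrite mulrA ler_wpM2r // mulrC -ler_pdivlMr //.
    exact: le_trans (pD n) small.
  by rewrite natrD; lra.
have y10 : 0 <= y1 by case/andP: y101.
have y20 : 0 <= y2 by case/andP: y201.
near=> n.
have n0 : (0 < n)%N by near: n; exists 1%N.
have /andP [p0 p1] := p01 n.
pose M : rel 'I_n := @hub_rel R k E n (p n) x1 x2 y1 y2.
apply: (@le_trans _ _ (#|[set q : 'I_n * 'I_n | M q.1 q.2]%SET|%:R * ln (p n)^-1)%:E).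
  apply: PhiH_le_planted => //.
  apply: le_trans (tdens_hub_rel E_irr Delta_pos n0 (p01 n) (eta := eta) _
    x10 x20 y101 y201 _ _ _).
  - rewrite mulrCA mulrC ler_wpM2l ?exprn_ge0 ?(ltW p0) //.
  - by rewrite ltW.
  - move=> x xs; have xle : x <= 1 + x1 + x2.
      by move: xs; rewrite !inE => /orP [] /eqP ->; lra.
    have x0 : 0 <= x by move: xs; rewrite !inE => /orP [] /eqP ->.
    have small : p n <= (1 + x1 + x2)^-1.
      by near: n; apply: near_small; rewrite invr_gt0.
    apply: le_trans (ler_pM _ _ xle (le_trans (pD n) small)) _ => //.
      by rewrite exprn_ge0 ?(ltW p0).
    by rewrite divff // gt_eqF.
  - move=> x; rewrite !inE => /orP [] /eqP ->; near: n; exact: x_big.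
  - move=> y; rewrite !inE => /or3P [] /eqP ->; near: n.
    + exact: (y_big 1 ler01).
    + exact: (y_big y1 y10).
    + exact: (y_big y2 y20).
rewrite lee_fin mulrA ler_wpM2r ?ln_ge0 ?invf_ge1 ?(ltW p1) //.
have -> : (x1 * y1 + x2 * y2) * (n%:R ^+ 2 * p n ^+ D) =
  (x1 * y1 + x2 * y2) * (p n ^+ D * n%:R * n%:R) by ring.
exact: card_hub_rel.
Unshelve. all: by end_near. Qed.

Lemma clique_bound (w delta : R) : 0 <= delta -> 0 < w ->
  regular E D ->
  (forall C : R, \forall n \near \oo, C <= p n ^+ D * n%:R ^+ 2) ->
  delta < w ^+ k ->
  \forall n \near \oo, (PhiH E n (p n) delta <=
    (w ^+ 2 * (n%:R ^+ 2 * p n ^+ D * ln (p n)^-1))%:E)%E.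
Proof.
move=> d0 w0 reg growth w_gt.
have w1 : 1 + delta < 1 + w ^+ k by rewrite ltrD2l.
have [eta /andP [eta0 eta1] etaf] := exists_loss k (ltr_pwDl ltr01 d0) w1.
have sqrt_pD n : Num.sqrt (p n) ^+ D = Num.sqrt (p n ^+ D).
  have /andP [/ltW p0 _] := p01 n; elim: D => [|d IH]; first by rewrite !expr0 sqrtr1.
  by rewrite !exprS IH sqrtrM.
have pD n : p n ^+ D <= p n.
  by have /andP [? ?] := p01 n; rewrite -[leRHS]expr1 ler_wiXn2l // ltW.
have small (C : R) : 0 < C -> \forall n \near \oo, Num.sqrt (p n) ^+ D <= C.
  move=> C0; near=> n; rewrite sqrt_pD -(ger0_norm (ltW C0)) -sqrtr_sqr.
  apply: ler_wsqrtr; apply: le_trans (pD n) _.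
  by near: n; apply: near_small; rewrite exprn_gt0.
near=> n.
have n0 : (0 < n)%N by near: n; exists 1%N.
have nR0 : 0 < n%:R :> R by rewrite ltr0n.
have /andP [p0 p1] := p01 n.
have q0 : 0 <= Num.sqrt (p n) ^+ D by rewrite exprn_ge0 ?sqrtr_ge0.
(* Squaring reduces this to the growth of [p n ^+ D * n%:R ^+ 2]. *)
have big : k.+1%:R / (eta * w) <= Num.sqrt (p n) ^+ D * n%:R.
  rewrite -(ler_pXn2r (n := 2)) ?nnegrE ?divr_ge0 ?mulr_ge0 ?(ltW eta0) ?(ltW w0) //.
  rewrite [X in _ <= X]exprMn sqrt_pD sqr_sqrtr ?exprn_ge0 ?(ltW p0) //.
  by near: n; exact: growth.
pose M : rel 'I_n := @clique_rel R k E n (p n) w.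
apply: (@le_trans _ _ (#|[set q : 'I_n * 'I_n | M q.1 q.2]%SET|%:R * ln (p n)^-1)%:E).
  apply: PhiH_le_planted => //.
  apply: le_trans (tdens_clique_rel E_irr Delta_pos reg n0 (p01 n) (eta := eta) _
    (ltW w0) _ _ _).
  - by rewrite mulrCA mulrC ler_wpM2l ?exprn_ge0 ?(ltW p0).
  - by rewrite ltW.
  - rewrite mulrC -ler_pdivlMr // mul1r.
    by near: n; apply: small; rewrite invr_gt0.
  - by rewrite mulrA mulrA -mulrA -ler_pdivrMl ?mulr_gt0 // mulrC.
  rewrite natrD.
  have : w * Num.sqrt (p n) ^+ D * n%:R <= eta / 2 * n%:R.
    rewrite ler_wpM2r // mulrC -ler_pdivlMr //.
    by near: n; apply: small; rewrite !divr_gt0.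
  have : k.+1%:R <= eta / 2 * n%:R.
    rewrite -ler_pdivrMl ?divr_gt0 //.
    by near: n; exact: nbhs_infty_ger.
  have : (Num.truncn (w * Num.sqrt (p n) ^+ D * n%:R))%:R
      <= w * Num.sqrt (p n) ^+ D * n%:R.
    by rewrite truncn_le !mulr_ge0 // ltW.
  lra.
rewrite lee_fin mulrA ler_wpM2r ?ln_ge0 ?invf_ge1 ?(ltW p1) //.
by apply: card_clique_rel => //; rewrite ltW.
Unshelve. all: by end_near. Qed.

End Asymptotics.

(** * Near-optimal parameters and conclusion *)

Theorem theorem1p4 (R : realType) (k : nat) (E : rel 'I_k)
  (E_irr : irreflexive E) (Delta_pos : (0 < maxdeg E)%N)
  (delta : R) (delta_pos : 0 < delta) :
  (* (a), first claim *)
  (forall p : nat -> R,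
     (forall n, 0 < p n < 1) ->
     p @ \oo --> 0 ->
     (fun n => powR n%:R (- ((maxdeg E)%:R)^-1) / p n) @ \oo --> 0 ->
     forall eps : R, 0 < eps -> \forall n \near \oo,
       (PhiH E n (p n) delta
        <= (FH E delta + eps%:E)
           * (n%:R ^+ 2 * p n ^+ maxdeg E * ln (p n)^-1)%:E)%E)
  /\
  (* (a), second claim *)
  FH E delta = FH_max1 E delta
  /\
  (* (b) *)
  (dconnected E -> regular E (maxdeg E) ->
   forall p : nat -> R,
     (forall n, 0 < p n < 1) ->
     p @ \oo --> 0 ->
     (fun n => powR n%:R (- (2 / (maxdeg E)%:R)) / p n) @ \oo --> 0 ->
     forall eps : R, 0 < eps -> \forall n \near \oo,
       (PhiH E n (p n) delta
        <= (powR delta (2 / k%:R) + eps)%:E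
           * (n%:R ^+ 2 * p n ^+ maxdeg E * ln (p n)^-1)%:E)%E)
  /\
  (* combination of (a) and (b) *)
  (dconnected E -> regular E (maxdeg E) ->
   forall p : nat -> R,
     (forall n, 0 < p n < 1) ->
     p @ \oo --> 0 ->
     (fun n => powR n%:R (- ((maxdeg E)%:R)^-1) / p n) @ \oo --> 0 ->
     forall eps : R, 0 < eps -> \forall n \near \oo,
       (PhiH E n (p n) delta
        <= (mine (FH E delta) (powR delta (2 / k%:R))%:E + eps%:E)
           * (n%:R ^+ 2 * p n ^+ maxdeg E * ln (p n)^-1)%:E)%E).
Proof.
have D0 : (maxdeg E)%:R != 0 :> R by rewrite pnatr_eq0 -lt0n.
have partA (p : nat -> R) : (forall n, 0 < p n < 1) -> p @ \oo --> 0 ->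
    (fun n => powR n%:R (- ((maxdeg E)%:R)^-1) / p n) @ \oo --> 0 ->
    forall eps : R, 0 < eps -> \forall n \near \oo,
      (PhiH E n (p n) delta <= (FH E delta + eps%:E)
        * (n%:R ^+ 2 * p n ^+ maxdeg E * ln (p n)^-1)%:E)%E.
  move=> p01 p_to0 p_big eps eps0.
  have scale_gt0 n : (0 < n)%N -> 0 < n%:R ^+ 2 * p n ^+ maxdeg E * ln (p n)^-1.
    move=> n0; have /andP [p0 p1] := p01 n.
    by rewrite !mulr_gt0 ?exprn_gt0 ?ltr0n // ln_gt0 // invf_gt1.
  (* No admissible point: the right side is [+oo] as soon as the scale is positive, which requires
     [0 < n], since [+oo] times 0 is 0. *)
  have [->|FH_fin] := eqVneq (FH E delta) +oo%E.
    near=> n; rewrite addye // gt0_mulye ?leey // lte_fin scale_gt0 //.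
    by near: n; exists 1%N.
  have FH0 : (0 <= FH E delta)%E.
    apply: le_ereal_inf_tmp => _ /= [x1 [x2 [y1 [y2 [adm ->]]]]].
    case: adm => x10 x20 /andP [y10 _] /andP [y20 _] _.
    by rewrite lee_fin addr_ge0 // mulr_ge0.
  have FHn : FH E delta \is a fin_num by rewrite ge0_fin_numE // ltey.
  have eps2 : 0 < eps / 2 by rewrite divr_gt0.
  (* Half of [eps] is spent on a near-optimal point, half on enlarging [x1] and [x2]. *)
  have : (FH E delta < FH E delta + (eps / 2)%:E)%E by rewrite lteDl.
  case/ereal_inf_lt => _ [x1 [x2 [y1 [y2 [[x10 x20 y101 y201 f] ->]]]]] cost.
  have /andP [y10 _] := y101; have /andP [y20 _] := y201.
  pose c := x1 * y1 + x2 * y2.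
  have c0 : 0 <= c by rewrite addr_ge0 // mulr_ge0.
  (* The cost grows by [eps / 2 * (c / (1 + c))], at most [eps / 2]; the summand 1 allows
     [c = 0]. *)
  pose s := 1 + eps / 2 / (1 + c).
  have s1 : 1 < s by rewrite ltrDl !divr_gt0 // ltr_wpDr.
  have sx x : 0 <= x -> 0 <= s * x by move=> x0; rewrite mulr_ge0 // ltW // (lt_trans ltr01).
  have growth C : \forall n \near \oo, C <= p n ^+ maxdeg E * n%:R.
    have := @near_growth R p p01 (maxdeg E) 1 Delta_pos; rewrite mul1r.
    exact.
  have f_gt : 1 + delta < fH E (s * x1) (s * x2) y1 y2.
    apply: lt_le_trans (fH_scale_ge Delta_pos (ltW s1) x10 x20 y10 y20).
    by rewrite f addrAC subrr add0r ltrD2l ltr_pMl.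
  have := hub_bound p01 p_to0 E_irr Delta_pos (ltW delta_pos) growth
    (sx _ x10) (sx _ x20) y101 y201 f_gt.
  move=> bound; near=> n.
  have n0 : (0 < n)%N by near: n; exists 1%N.
  apply: (@le_trans _ _ ((s * x1 * y1 + s * x2 * y2) *
    (n%:R ^+ 2 * p n ^+ maxdeg E * ln (p n)^-1))%:E); first by near: n.
  rewrite EFinM; apply: lee_wpmul2r; first by rewrite lee_fin ltW // scale_gt0.
  move: cost; rewrite -(fineK FHn) -!EFinD lte_fin lee_fin -/c => cost.
  have -> : s * x1 * y1 + s * x2 * y2 = c + eps / 2 * (c / (1 + c)).
    by rewrite /s /c; field; rewrite gt_eqF // ltr_wpDr.
  have : eps / 2 * (c / (1 + c)) <= eps / 2.
    by rewrite ler_piMr ?(ltW eps2) // ler_pdivrMr ?ltr_wpDr // mul1r lerDr.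
  lra.
have partB : dconnected E -> regular E (maxdeg E) ->
   forall p : nat -> R, (forall n, 0 < p n < 1) -> p @ \oo --> 0 ->
     (fun n => powR n%:R (- (2 / (maxdeg E)%:R)) / p n) @ \oo --> 0 ->
     forall eps : R, 0 < eps -> \forall n \near \oo,
       (PhiH E n (p n) delta <= (powR delta (2 / k%:R) + eps)%:E
           * (n%:R ^+ 2 * p n ^+ maxdeg E * ln (p n)^-1)%:E)%E.
  move=> _ reg p p01 p_to0 p_big eps eps0.
  have k0 := maxdeg_gt0_card Delta_pos.
  have kR0 : k%:R != 0 :> R by rewrite pnatr_eq0 -lt0n.
  pose v := powR delta (k%:R^-1).
  have v0 : 0 < v by rewrite powR_gt0.
  have vk : v ^+ k = delta by rewrite -powR_mulrn ?ltW // -powRrM mulVf // powRr1 // ltW.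
  have v2 : v ^+ 2 = powR delta (2 / k%:R).
    by rewrite -powR_mulrn ?ltW // -powRrM mulrC.
  (* At [v] the clique contributes exactly [delta]. This [w] is larger, and its cost [w ^+ 2] is
     precisely the coefficient to be reached. *)
  pose w := Num.sqrt (v ^+ 2 + eps).
  have w2 : w ^+ 2 = v ^+ 2 + eps by rewrite sqr_sqrtr // addr_ge0 ?exprn_ge0 // ltW.
  have w0 : 0 < w by rewrite sqrtr_gt0 addr_gt0 ?exprn_gt0.
  have vw : v < w.
    by rewrite -(ltr_pXn2r (n := 2)) ?nnegrE ?(ltW v0) ?(ltW w0) // w2 ltrDl.
  have w_gt : delta < w ^+ k by rewrite -vk ltr_pXn2r // nnegrE ltW.
  have bound := clique_bound p01 p_to0 E_irr Delta_pos (ltW delta_pos) w0 reg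
    (near_growth p01 Delta_pos p_big) w_gt.
  by rewrite -v2 -w2; apply: filterS bound => n; rewrite EFinM.
split=> //; split; first exact: FH_eq_FH_max1.
split=> // conn reg p p01 p_to0 p_big eps eps0.
(* For [n >= 1] the exponent [-2 / D] gives a smaller power than [-1 / D], so (b) applies in the
   range of (a). *)
have p_big2 : (fun n => powR n%:R (- (2 / (maxdeg E)%:R)) / p n) @ \oo --> 0.
  apply: (@squeeze_cvgr _ _ _ _ (fun=> 0)
    (fun n => powR n%:R (- ((maxdeg E)%:R)^-1) / p n)) => //; last exact: cvg_cst.
  near=> n; have /andP [p0 _] := p01 n.
  rewrite divr_ge0 ?powR_ge0 ?(ltW p0) //= ler_wpM2r ?invr_ge0 ?(ltW p0) //.
  apply: ler_powR; first by rewrite ler1n; near: n; exists 1%N.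
  by rewrite lerN2 -[leLHS]mul1r ler_wpM2r ?invr_ge0 // ler1n.
(* Neither coefficient depends on [n], so the minimum selects one of the two bounds once and for
   all. *)
rewrite minEle; case: ifP => _; first exact: partA.
by rewrite -EFinD; apply: partB.
Unshelve. all: by end_near. Qed.
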